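(* Let $(X,Q,\pi)$ be a finite Markov chain with $\pi_{\max}<\frac14$, $Q_{\min}<1$ and $R_0:=\frac{\log(4\pi_{\max})}{\log(Q_{\min})}>0$. Then the average mixing time satisfies $$\tau_{\rm avg}(1/4)\ge\left(\frac{\pi_{\min}}{8\pi_{\max}}\right)^{\frac1{R_0}}\frac{Q_{\min}}{e}R_0.$$
   Context: A finite Markov chain $(X,Q,\pi)$ is always assumed irreducible and reversible: $X$ is a finite set, $Q:X\times X\to[0,1]$ satisfies $\sum_{y}Q(x,y)=1$ for all $x$ and is irreducible, $\pi\in(0,1]^X$ is the unique stationary probability measure, and $Q(x,y)\pi(x)=Q(y,x)\pi(y)$ for all $x,y$. Write $x\sim y$ if $x\ne y$ and $Q(x,y)>0$. Notation: $\pi_{\min}=\min_x\pi(x)$, $\pi_{\max}=\max_x\pi(x)$, $Q_{\min}=\min_{x\sim y}Q(x,y)$. $\Delta f(x)=\sum_{y}(f(y)-f(x))Q(x,y)$ and $P_t=e^{t\Delta}$ is the heat semigroup. The heat kernel is $p_t(x,y)=\frac1{\pi(x)}(P_t\mathbf{1}_x)(y)$, where $\mathbf{1}_x$ is the indicator function of $\{x\}$. The average mixing time is $\tau_{\rm avg}(\varepsilon)=\inf\{t>0:\sum_{x,y\in X}\pi(x)\pi(y)|p_t(x,y)-1|\le\varepsilon\}$. *)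

(* Defs.v *)
From mathcomp Require Import all_boot all_order all_algebra.
From mathcomp Require Import all_classical all_reals all_analysis.

Set Implicit Arguments.
Unset Strict Implicit.
Unset Printing Implicit Defensive.

Import Order.TTheory GRing.Theory Num.Theory numFieldNormedType.Exports.
Local Open Scope classical_set_scope.
Local Open Scope ring_scope.

Section FiniteMarkovChain.
Context {R : realType} {X : finType}.
Implicit Types (Q : X -> X -> R) (pi : X -> R) (f : X -> R).

(* Irreducibility makes the stationary probability measure unique, so
   stationarity of [pi] determines it. *)
Record finite_markov_chain Q pi : Prop := FiniteMarkovChain {
  kernel_itv : forall x y, 0 <= Q x y <= 1;
  kernel_sum : forall x, \sum_y Q x y = 1;
  kernel_irreducible : forall x y, connect [rel u v | 0 < Q u v] x y;
  measure_itv : forall x, 0 < pi x <= 1;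
  measure_sum : \sum_x pi x = 1;
  measure_stationary : forall y, \sum_x pi x * Q x y = pi y;
  measure_reversible : forall x y, Q x y * pi x = Q y x * pi y }.

Definition adj Q : rel X := [rel x y | (x != y) && (0 < Q x y)].

(* All the values below lie in [0, 1], so the units 1 of the minima and 0 of
   the maximum only matter when the range is empty. *)
Definition pi_min pi : R := \big[Num.min/1]_(x : X) pi x.

Definition pi_max pi : R := \big[Num.max/0]_(x : X) pi x.

Definition Q_min Q : R := \big[Num.min/1]_(p : X * X | adj Q p.1 p.2) Q p.1 p.2.

Definition laplacian Q f (x : X) : R := \sum_y (f y - f x) * Q x y.

(* exp(t Delta) f as the pointwise sum of t^k / k! * Delta^k f. *)
Definition heat_semigroup Q (t : R) f (x : X) : R :=
  limn (series (fun k => exp_coeff t k * iter k (laplacian Q) f x)).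

Definition heat_kernel Q pi (t : R) (x y : X) : R :=
  (pi x)^-1 * heat_semigroup Q t (fun z => (z == x)%:R) y.

Definition avg_mixing_time Q pi (eps : R) : \bar R :=
  ereal_inf [set t%:E | t in [set t : R | 0 < t /\
    \sum_x \sum_y pi x * pi y * `|heat_kernel Q pi t x y - 1| <= eps]].

Definition R0 Q pi : R := ln (4 * pi_max pi) / ln (Q_min Q).

End FiniteMarkovChain.

(* Main.v *)
Require Import Defs.
From mathcomp Require Import all_boot all_order all_algebra.
From mathcomp Require Import all_classical all_reals all_analysis.
From mathcomp Require Import ring lra.

(** Up to time t the heat flow is the chain Q run along a Poisson clock of rate
    one, so by time t it has made at least n jumps with probability at most
    t^n/n!.  Take n = r + 1 with r the integer part of R0.  For the times t in
    question, t < c^(1/R0) (Q_min/e) R0 with c = pi_min/(8 pi_max) <= 1/8, the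
    inequality t^n/n! <= (te/n)^n makes that probability at most c, because
    n > R0 ([exp_coeff_short_time]).  Hence all but 1/8 of the mass started at a
    state x is still within r steps of x.

    The states within r steps are too few to carry the stationary mass.  A state
    has at most 1/Q_min neighbours, so at most Q_min^-k states end a walk of
    length k ([card_walk_ends]).  An irreducible chain whose states all have
    measure less than 1/4 must branch somewhere, so Q_min <= 1/2
    ([Q_min_le_half]), and the ball of radius r has at most 2 Q_min^-r states.
    As r <= R0 means 4 pi_max <= Q_min^r, the ball has measure at most 1/2
    ([pi_walk_ball_le]).

    Outside the ball pi has mass at least 1/2 and p_t(x, .) pi has mass at most
    1/8, so for every x the L1 distance of p_t(x, .) to 1 is at least 3/8 > 1/4
    ([l1_distance_ge]).

    The analytic work is the Poisson clock, since the semigroup is defined as the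
    series of t^k/k! (Q - 1)^k.  Expanding (Q - 1)^k by the binomial theorem
    gives a Cauchy product with the series of exp(-t); its partial sums differ
    from exp(-t) times those of t^j/j! Q^j by at most e^t (2t)^N/N!, which tends
    to 0 ([cvg_series_binomial_transform]). *)

Set Implicit Arguments.
Unset Strict Implicit.
Unset Printing Implicit Defensive.

Import Order.TTheory GRing.Theory Num.Theory numFieldNormedType.Exports.
Local Open Scope ring_scope.

(** * Estimates on the exponential series *)

Section ExponentialSeries.
Local Open Scope classical_set_scope.
Context {R : realType}.
Implicit Types (x t : R) (a : nat -> R).

Lemma fact_gt0R n : 0 < n`!%:R :> R.
Proof. by rewrite ltr0n fact_gt0. Qed.

Lemma exp_coeffD_le t m k :
  0 <= t -> exp_coeff t (m + k)%N <= exp_coeff t m * exp_coeff t k.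
Proof.
move=> t0; rewrite /exp_coeff /= exprD mulf_div ler_wpM2l//.
  by rewrite mulr_ge0 ?exprn_ge0.
rewrite lef_pV2 ?posrE ?mulr_gt0 ?fact_gt0R// -natrM ler_nat.
have := bin_fact (leq_addr k m); rewrite addKn => <-.
by rewrite leq_pmull// bin_gt0 leq_addr.
Qed.

Lemma series_exp_le t n : 0 <= t -> series (exp_coeff t) n <= expR t.
Proof.
move=> t0; rewrite /expR; apply: nondecreasing_cvgn_le (is_cvg_series_exp_coeff t) n.
by apply/nondecreasing_seqP => n; rewrite -subr_ge0 seriesSB exp_coeff_ge0.
Qed.

Lemma exp_tail_le t m n :
  0 <= t -> \sum_(m <= k < n) exp_coeff t k <= exp_coeff t m * expR t.
Proof.
move=> t0; have c0 := exp_coeff_ge0 m t0.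
have [nm|mn] := leqP n m; first by rewrite big_geq// mulr_ge0// expR_ge0.
rewrite -{1}[m]add0n big_addn.
apply: le_trans (ler_wpM2l c0 (series_exp_le (n - m) t0)).
rewrite /series /= mulr_sumr; apply: ler_sum => k _.
by rewrite addnC exp_coeffD_le.
Qed.

(** The tail of the alternating series is at most the tail of the series of
    exp(t), term by term. *)
Lemma exp_remainder_le t n : 0 <= t ->
  `|series (exp_coeff (- t)) n - expR (- t)| <= exp_coeff t n * expR t.
Proof.
move=> t0.
have cv : `|series (exp_coeff (- t)) n - series (exp_coeff (- t)) k| @[k --> \oo]
    --> `|series (exp_coeff (- t)) n - expR (- t)|.
  apply: cvg_norm; apply: cvgB; first exact: cvg_cst.
  exact: is_cvg_series_exp_coeff.
rewrite -(cvg_lim _ cv)//; apply: limr_le; first by apply/cvg_ex; eexists; exact: cv.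
near=> k; have nk : (n <= k)%N by near: k; exact: nbhs_infty_ge.
rewrite distrC sub_series_geq//; apply: le_trans (exp_tail_le n k t0).
apply: le_trans (ler_norm_sum _ _ _) _; apply: ler_sum => i _.
by rewrite /exp_coeff /= normrM normrX normrN (ger0_norm t0) gtr0_norm.
Unshelve. all: by end_near. Qed.

Lemma exp_coeff_double t n :
  exp_coeff (t + t) n = \sum_(j < n.+1) exp_coeff t j * exp_coeff t (n - j)%N.
Proof.
rewrite /exp_coeff /= exprDn mulr_suml; apply: eq_bigr => j _.
have jn : (j <= n)%N by rewrite -ltnS.
have := congr1 (fun k => k%:R : R) (bin_fact jn); rewrite !natrM => <-.
rewrite -mulr_natr; field.
by rewrite !gt_eqF ?fact_gt0R// ltr0n bin_gt0.
Qed.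

(** The k-th finite difference of [a] at 0; with a_j = (Q^j f)(x) it is
    ((Q - 1)^k f)(x). *)
Definition binomial_transform a k : R :=
  \sum_(j < k.+1) (-1) ^+ (k - j) * 'C(k, j)%:R * a j.

(** Pascal's rule. *)
Lemma binomial_transformS (a : nat -> R) k :
  binomial_transform a k.+1 =
  binomial_transform (fun j => a j.+1) k - binomial_transform a k.
Proof.
rewrite /binomial_transform big_ord_recl /=.
(* The extra term j = k + 1 vanishes since C(k, k + 1) = 0. *)
have -> : \sum_(j < k.+1) (-1) ^+ (k - j) * 'C(k, j)%:R * a j =
    \sum_(j < k.+2) (-1) ^+ (k - j) * 'C(k, j)%:R * a j.
  by rewrite [RHS]big_ord_recr /= bin_small// mulr0 mul0r addr0.
rewrite [in RHS](big_ord_recl k.+1) /= opprD addrCA; congr (_ + _).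
  by rewrite !subn0 !bin0 exprS; ring.
rewrite -sumrB; apply: eq_bigr => j _; rewrite /bump /= !add1n subSS binS natrD.
have [jk|kj] := ltnP j k; first by rewrite -(subnSK jk) exprS; ring.
by rewrite [X in 'C(_, X)]/= bin_small ?ltnS//; ring.
Qed.

(** Since t^k/k! C(k,j) (-1)^(k-j) = t^j/j! (-t)^(k-j)/(k-j)!, summing over the
    triangle j <= k < n by columns leaves a partial sum of exp(-t) in column j. *)
Lemma series_binomial_transform a t n :
  series (fun k => exp_coeff t k * binomial_transform a k) n =
  \sum_(j < n) exp_coeff t j * a j * series (exp_coeff (- t)) (n - j)%N.
Proof.
elim: n => [|n IHn]; first by rewrite big_ord0 /series /= big_geq.
rewrite seriesSr IHn.
under [RHS]eq_bigr => j _.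
  have jn : (j <= n)%N by rewrite -ltnS.
  rewrite subSn// seriesSr mulrDr; over.
(* The new column j = n starts with an empty partial sum. *)
rewrite big_split /= [in RHS]big_ord_recr /= subnn.
rewrite [series _ 0%N]/series /= big_geq// mulr0 addr0; congr (_ + _).
rewrite mulr_sumr; apply: eq_bigr => j _.
have jn : (j <= n)%N by rewrite -ltnS.
rewrite /exp_coeff /=.
rewrite -[in X in t ^+ n / X](bin_fact jn) !natrM.
rewrite -{1}(subnKC jn) exprD [(- t) ^+ _]exprNn.
by field; rewrite !gt_eqF ?fact_gt0R// ltr0n bin_gt0.
Qed.

Lemma is_cvg_exp_series_bounded a t : 0 <= t -> (forall j, `|a j| <= 1) ->
  cvgn (series (fun j => exp_coeff t j * a j)).
Proof.
move=> t0 a1; apply: normed_cvg; apply: series_le_cvg (is_cvg_series_exp_coeff t).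
- by move=> n /=.
- by move=> n; exact: exp_coeff_ge0.
- move=> n /=; rewrite normrM ger0_norm ?exp_coeff_ge0//.
  by rewrite ler_piMr ?exp_coeff_ge0.
Qed.

(** Multiplying the exponential generating function by exp(-t) is the binomial
    transform.  Replacing the partial sum in column j by exp(-t) costs
    e^t t^(n-j)/(n-j)!, and the columns together cost e^t (2t)^n/n!. *)
Lemma cvg_series_binomial_transform a t : 0 <= t -> (forall j, `|a j| <= 1) ->
  series (fun k => exp_coeff t k * binomial_transform a k) @ \oo -->
  expR (- t) * limn (series (fun j => exp_coeff t j * a j)).
Proof.
move=> t0 a1; set A := series (fun j => exp_coeff t j * a j).
set U := series _.
have cvA : expR (- t) * A n @[n --> \oo] --> expR (- t) * limn A.
  by apply: cvgMl_tmp; exact: is_cvg_exp_series_bounded.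
have err n : `|U n - expR (- t) * A n| <= expR t * exp_coeff (t + t) n.
  rewrite /U series_binomial_transform /A /series /= big_mkord mulr_sumr -sumrB.
  apply: le_trans (ler_norm_sum _ _ _) _.
  rewrite exp_coeff_double big_ord_recr /= mulrDr mulr_sumr.
  rewrite -[leLHS]addr0; apply: lerD; last first.
    by rewrite mulr_ge0 ?expR_ge0// mulr_ge0 ?exp_coeff_ge0.
  apply: ler_sum => j _.
  rewrite [expR _ * _]mulrC -mulrBr normrM normrM [`|exp_coeff t j|]ger0_norm;
    last exact: exp_coeff_ge0.
  rewrite mulrCA -mulrA ler_wpM2l ?exp_coeff_ge0//.
  rewrite -[leRHS]mul1r ler_pM//.
  by rewrite mulrC exp_remainder_le.
have cv0 : U n - expR (- t) * A n @[n --> \oo] --> (0 : R).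
  apply: norm_cvg0; apply: squeeze_cvgr (cvg_cst 0) _; last first.
    rewrite -[X in _ --> X](mulr0 (expR t)); apply: cvgMl_tmp.
    exact: (cvg_exp_coeff (t + t)).
  by near=> n; apply/andP; split; [exact: normr_ge0 | exact: err].
rewrite -[X in _ --> X]add0r.
have -> : U = fun n => (U n - expR (- t) * A n) + expR (- t) * A n.
  by apply/funext => n; rewrite subrK.
exact: cvgD.
Unshelve. all: by end_near. Qed.

(** Equivalent to n! >= (n/e)^n, which holds because n^n/n! is one term of the
    series of e^n. *)
Lemma exp_coeff_le_pow t (n : nat) : 0 <= t -> (0 < n)%N ->
  exp_coeff t n <= (t * expR 1 / n%:R) ^+ n.
Proof.
move=> t0 n0; have nR : 0 < n%:R :> R by rewrite ltr0n.
have : exp_coeff (n%:R : R) n <= expR n%:R.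
  apply: le_trans (series_exp_le n.+1 (ltW nR)).
  rewrite seriesSr lerDr /series /=.
  by apply: sumr_ge0 => i _; exact/exp_coeff_ge0/ltW.
rewrite /exp_coeff /= ler_pdivrMr ?fact_gt0R// => h.
have en : expR 1 ^+ n = expR n%:R :> R by rewrite -expRM_natl mulr1.
rewrite ler_pdivrMr ?fact_gt0R// expr_div_n exprMn en -!mulrA ler_peMr ?exprn_ge0//.
by rewrite [_^-1 * _]mulrC mulrA ler_pdivlMr ?exprn_gt0// mul1r.
Qed.
End ExponentialSeries.

(** * The union bound *)

Lemma sum_bigcup_le (R : numDomainType) (I T : finType) (P : pred I)
    (S : I -> {set T}) (f : T -> R) : (forall y, 0 <= f y) ->
  \sum_(y in \bigcup_(i | P i) S i) f y <= \sum_(i | P i) \sum_(y in S i) f y.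
Proof.
move=> f0.
under [leRHS]eq_bigr => i _ do rewrite big_mkcond.
rewrite exchange_big /= [leLHS]big_mkcond; apply: ler_sum => y _.
case: bigcupP => [[i Pi yi]|_]; last by apply: sumr_ge0 => i _; case: ifP.
by rewrite (bigD1 i)//= yi lerDl; apply: sumr_ge0 => j _; case: ifP.
Qed.

(** * The heat semigroup as a Poisson mixture *)

Section Steps.
Context {R : realType} {X : finType}.
Implicit Types (Q : X -> X -> R) (pi f : X -> R).

Definition markov_step Q f x : R := \sum_y Q x y * f y.

(** The binomial theorem for (Q - 1)^k, valid because the rows of Q sum to 1, so
    that the Laplacian is Q - 1. *)
Lemma iter_laplacian Q f k x : (forall x, \sum_y Q x y = 1) ->
  iter k (laplacian Q) f x =
  binomial_transform (fun j => iter j (markov_step Q) f x) k.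
Proof.
move=> Q1; elim: k x => [|k IHk] x.
  by rewrite /binomial_transform big_ord1 /= mulr1 mul1r.
rewrite binomial_transformS -IHk iterS {1}/laplacian.
under eq_bigr => y _ do rewrite mulrBl.
rewrite sumrB -mulr_sumr Q1 mulr1; congr (_ - _).
rewrite /binomial_transform.
under [RHS]eq_bigr => j _ do rewrite iterS /markov_step mulr_sumr.
rewrite exchange_big /=; apply: eq_bigr => y _.
by rewrite IHk /binomial_transform mulr_suml; apply: eq_bigr => j _; ring.
Qed.

Section Chain.
Context Q pi (chain : finite_markov_chain Q pi).

Let Q_ge0 x y : 0 <= Q x y. Proof. by case/andP: (kernel_itv chain x y). Qed.
Let pi_gt0 x : 0 < pi x. Proof. by case/andP: (measure_itv chain x). Qed.

Lemma iter_markov_step_ge0 f k x :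
  (forall y, 0 <= f y) -> 0 <= iter k (markov_step Q) f x.
Proof.
by move=> f0; elim: k x => //= k IHk x; apply: sumr_ge0 => y _; rewrite mulr_ge0.
Qed.

Lemma iter_markov_step_norm f k x :
  (forall y, `|f y| <= 1) -> `|iter k (markov_step Q) f x| <= 1.
Proof.
move=> f1; elim: k x => //= k IHk x; rewrite -(kernel_sum chain x).
apply: le_trans (ler_norm_sum _ _ _) _; apply: ler_sum => y _.
by rewrite normrM ger0_norm// ler_piMr.
Qed.

(** Stationarity of pi, iterated. *)
Lemma sum_iter_markov_step f k :
  \sum_x pi x * iter k (markov_step Q) f x = \sum_x pi x * f x.
Proof.
elim: k => //= k <-.
under eq_bigr => x _ do rewrite mulr_sumr.
rewrite exchange_big /=; apply: eq_bigr => y _.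
by rewrite -(measure_stationary chain y) mulr_suml; apply: eq_bigr => x _; rewrite mulrA.
Qed.

(** P_t f is the expectation of Q^N f with N Poisson of mean t. *)
Lemma heat_semigroup_cvg f t x : 0 <= t -> (forall y, `|f y| <= 1) ->
  (expR (- t) * series (fun j => exp_coeff t j * iter j (markov_step Q) f x) n
     @[n --> \oo] --> heat_semigroup Q t f x)%classic.
Proof.
move=> t0 f1; rewrite /heat_semigroup.
have b1 j := iter_markov_step_norm j x f1.
have -> : (fun k => exp_coeff t k * iter k (laplacian Q) f x) =
    (fun k => exp_coeff t k *
       binomial_transform (fun j => iter j (markov_step Q) f x) k).
  by apply/funext => k; rewrite iter_laplacian//; exact: kernel_sum chain.
rewrite (cvg_lim _ (cvg_series_binomial_transform t0 b1))//.
by apply: cvgMl_tmp; exact: is_cvg_exp_series_bounded.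
Qed.

(** Only the event of at least n jumps contributes to the mass in A.  The k-step
    densities have total mass 1 by stationarity, and the Poisson tail
    e^(-t) (t^n/n! + ...) is at most t^n/n!. *)
Lemma heat_mass_le (A : {set X}) x n t : 0 <= t ->
    (forall j y, (j < n)%N -> y \in A ->
       iter j (markov_step Q) (fun z => (z == x)%:R) y = 0) ->
  \sum_(y in A) pi y * heat_kernel Q pi t x y <= exp_coeff t n.
Proof.
move=> t0 A0; set f := fun z : X => (z == x)%:R : R.
have f0 y : 0 <= f y by rewrite /f; case: eqP.
have f1 y : `|f y| <= 1 by rewrite /f; case: eqP; rewrite ?normr1 ?normr0.
pose g j := \sum_(y in A) pi y * iter j (markov_step Q) f y.
have gle j : g j <= pi x.
  apply: le_trans (_ : \sum_y pi y * f y <= _).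
    rewrite -(sum_iter_markov_step f j) /g [leLHS]big_mkcond.
    apply: ler_sum => y _; case: ifP => // _.
    by apply: mulr_ge0; [exact: ltW | exact: iter_markov_step_ge0].
  rewrite (bigD1 x)//= /f eqxx mulr1 big1 ?addr0// => y /negbTE->.
  by rewrite mulr0.
have g0 j : (j < n)%N -> g j = 0.
  by move=> jn; rewrite /g big1// => y yA; rewrite A0// mulr0.
rewrite /heat_kernel.
under eq_bigr => y _ do rewrite mulrCA.
rewrite -mulr_sumr mulrC ler_pdivrMr//.
have cv : (\sum_(y in A) pi y * (expR (- t) *
    series (fun j => exp_coeff t j * iter j (markov_step Q) f y) m)
    @[m --> \oo] --> \sum_(y in A) pi y * heat_semigroup Q t f y)%classic.
  apply: (cvg_big add_continuous) => y _; apply: cvgMl_tmp; exact: heat_semigroup_cvg.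
rewrite -(cvg_lim _ cv)//; apply: limr_le; first by apply/cvg_ex; eexists; exact: cv.
near=> m.
have -> : \sum_(y in A) pi y * (expR (- t) *
    series (fun j => exp_coeff t j * iter j (markov_step Q) f y) m) =
    expR (- t) * \sum_(0 <= j < m) exp_coeff t j * g j.
  rewrite [RHS]mulr_sumr /g.
  under [RHS]eq_bigr => j _ do rewrite mulr_sumr mulr_sumr.
  rewrite [RHS]exchange_big /=; apply: eq_bigr => y _.
  by rewrite /series /= !mulr_sumr; apply: eq_bigr => j _; ring.
have nm : (n <= m)%N by near: m; exact: nbhs_infty_ge.
rewrite (big_cat_nat _ nm)//= big1_seq ?add0r; last first.
  by move=> j; rewrite mem_index_iota => /andP[_ jn]; rewrite g0 ?mulr0.
rewrite expRN ler_pdivrMl ?expR_gt0// mulrCA mulrA.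
apply: le_trans (_ : (\sum_(n <= j < m) exp_coeff t j) * pi x <= _).
  by rewrite mulr_suml; apply: ler_sum => j _; rewrite ler_wpM2l ?exp_coeff_ge0.
by rewrite ler_wpM2r ?(ltW (pi_gt0 x))// exp_tail_le.
Unshelve. all: by end_near. Qed.

(** * Growth of balls *)

Lemma adjC x y : adj Q x y = adj Q y x.
Proof.
rewrite /adj /= eq_sym; congr (_ && _).
by rewrite -(pmulr_lgt0 _ (pi_gt0 x)) (measure_reversible chain) pmulr_lgt0.
Qed.

(** Walks move along [adj], which has no loops: a state where Q holds still has
    no lower bound on its holding probability, so Q_min would not control the
    number of walks if holding steps were allowed. *)
Fixpoint walk_ends x k : {set X} :=
  if k is k'.+1 then \bigcup_(z in walk_ends x k') [set y | adj Q z y]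
  else [set x].

Definition walk_ball x n : {set X} := \bigcup_(k < n) walk_ends x k.

(** Deleting the holding steps of a chain trajectory of length j leaves a walk of
    length at most j. *)
Lemma walk_ball_support x j y :
  iter j (markov_step Q) (fun z => (z == x)%:R) y != 0 -> y \in walk_ball x j.+1.
Proof.
elim: j y => [|j IHj] y /=.
  case: (eqVneq y x) => [-> _|_]; last by rewrite eqxx.
  by apply/bigcupP; exists ord0; rewrite //= inE.
move=> nz.
have [z] : exists z,
    Q y z * iter j (markov_step Q) (fun z => (z == x)%:R) z != 0.
  apply/existsP; apply: contraNT nz => /existsPn h.
  by rewrite /markov_step big1// => z _; apply/eqP; move: (h z); rewrite negbK.
rewrite mulf_eq0 negb_or => /andP[Qyz /IHj /bigcupP[k _ zk]].
have [->|yz] := eqVneq y z.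
  by apply/bigcupP; exists (widen_ord (leqnSn _) k).
apply/bigcupP; exists (lift ord0 k) => //=.
apply/bigcupP; exists z => //; rewrite inE adjC.
by rewrite /adj /= yz lt_def Qyz Q_ge0.
Qed.

Lemma Q_min_le x y : adj Q x y -> Q_min Q <= Q x y.
Proof. by move=> xy; exact: (bigmin_le_cond _ (j := (x, y))). Qed.

Lemma Q_min_gt0 : 0 < Q_min Q.
Proof. by apply/bigmin_gtP; split => // -[x y] /andP[]. Qed.

(** Each neighbour receives at least Q_min of the unit mass leaving z. *)
Lemma neighbours_le z : \sum_(y in [set y | adj Q z y]) Q_min Q <= 1.
Proof.
rewrite -(kernel_sum chain z) big_mkcond; apply: ler_sum => y _.
by case: ifP => //; rewrite inE; exact: Q_min_le.
Qed.

Lemma card_walk_ends x k : #|walk_ends x k|%:R * Q_min Q ^+ k <= 1.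
Proof.
elim: k => [|k IHk]; first by rewrite /= cards1 mulr1.
apply: le_trans IHk; rewrite exprS mulrA mulr_natl -sumr_const.
rewrite ler_wpM2r ?exprn_ge0 ?(ltW Q_min_gt0)//.
apply: le_trans (sum_bigcup_le _ _ _) _; first by move=> _; exact/ltW/Q_min_gt0.
by rewrite -sum1_card natr_sum; apply: ler_sum => z _; exact: neighbours_le.
Qed.

Lemma pi_le_max x : pi x <= pi_max pi.
Proof. exact: le_bigmax. Qed.

Lemma state_exists : exists x : X, true.
Proof.
have /card_gt0P[x _] : (0 < #|X|)%N; last by exists x.
rewrite lt0n; apply: contra_eqN (measure_sum chain) => /eqP X0.
by rewrite big_pred0 ?(eq_sym 0) ?oner_eq0// => x; have := card0_eq X0 x.
Qed.

(** If Q_min > 1/2, two neighbours of one state would together receive more than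
    the whole mass leaving it, so every state has at most one neighbour.  By
    reversibility and irreducibility there are then at most two states, of total
    measure at most 2 pi_max < 1. *)
Lemma Q_min_le_half : pi_max pi < 4^-1 -> Q_min Q <= 2^-1.
Proof.
move=> pi4; rewrite leNgt; apply/negP => Qh.
have nbr1 z u v : adj Q z u -> adj Q z v -> u = v.
  move=> zu zv; apply/eqP; apply: contraTT Qh => uv; rewrite -leNgt.
  have := neighbours_le z.
  rewrite (bigD1 u) ?inE//= (bigD1 v) /=; last by rewrite inE zv eq_sym uv.
  set s := (X in _ + (_ + X)).
  have : 0 <= s by apply: sumr_ge0 => *; exact/ltW/Q_min_gt0.
  by lra.
have [x _] := state_exists.
(* w is the neighbour of x; the default x makes the pair a single state when x
   has none. *)
pose w := odflt x [pick y | adj Q x y].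
have closed_xw y z : y \in [set x; w] -> 0 < Q y z -> z \in [set x; w].
  rewrite /w; case: pickP => [v xv|nox] /=; last first.
    rewrite !inE orbb => /eqP-> xz; rewrite orbb; apply/negPn/negP => zx.
    by have := nox z; rewrite /adj /= eq_sym zx xz.
  rewrite !inE => /orP[] /eqP-> yz; apply/orP.
    have [->|zx] := eqVneq z x; first by left.
    by right; apply/eqP; apply: (nbr1 x) => //; rewrite /adj /= eq_sym zx.
  have [->|zv] := eqVneq z v; first by right.
  by left; apply/eqP; apply: (nbr1 v); rewrite 1?[adj Q v x]adjC// /adj /= eq_sym zv.
have all_xw y : y \in [set x; w].
  have /connectP[p + ->] := kernel_irreducible chain x y.
  have : x \in [set x; w] by rewrite !inE eqxx.
  move: {1 3 4}x; elim: p => //= z p IHp u uxw /andP[uz zp].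
  exact: IHp (closed_xw _ _ uxw uz) zp.
have := sum_bigcup_le (fun _ : bool => true)
  (fun b => [set if b then x else w]) (fun y => ltW (pi_gt0 y)).
rewrite !big_bool /= !big_set1.
under eq_bigl => y do rewrite all_xw.
rewrite (measure_sum chain) => /le_trans/(_ (lerD (pi_le_max x) (pi_le_max w))).
by lra.
Qed.

(** For q <= 1/2 the last term of the sum of q^-k dominates all the others
    together. *)
Lemma geometric_sum_le (q : R) n : 0 < q <= 2^-1 ->
  (\sum_(k < n.+1) q ^- k) * q ^+ n <= 2.
Proof.
move=> /andP[q0 q2]; elim: n => [|n IHn]; first by rewrite big_ord1 invr1 mul1r; lra.
rewrite big_ord_recr /= mulrDl mulVf ?expf_neq0 ?gt_eqF// exprS mulrCA.
apply: le_trans (_ : q * 2 + 1 <= _); last by lra.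
by rewrite lerD2r ler_wpM2l// ltW.
Qed.

Lemma pi_walk_ball_le x n : pi_max pi < 4^-1 ->
  4 * pi_max pi <= Q_min Q ^+ n -> \sum_(y in walk_ball x n.+1) pi y <= 2^-1.
Proof.
move=> pi4 piq; have q0 := Q_min_gt0; have qh := Q_min_le_half pi4.
have qn0 : 0 < Q_min Q ^+ n by rewrite exprn_gt0.
have p0 : 0 <= pi_max pi := le_trans (ltW (pi_gt0 x)) (pi_le_max x).
apply: le_trans (sum_bigcup_le _ _ (fun y => ltW (pi_gt0 y))) _.
apply: le_trans (_ : pi_max pi * \sum_(k < n.+1) Q_min Q ^- k <= _).
  rewrite mulr_sumr; apply: ler_sum => k _.
  apply: le_trans (_ : \sum_(y in walk_ends x k) pi_max pi <= _).
    by apply: ler_sum => y _; exact: pi_le_max.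
  rewrite sumr_const -mulr_natr ler_wpM2l// -[leRHS]mul1r ler_pdivlMr ?exprn_gt0//.
  exact: card_walk_ends.
have h := @geometric_sum_le (Q_min Q) n; rewrite q0 qh in h.
rewrite -(ler_pM2r qn0) -mulrA.
by apply: le_trans (ler_wpM2l p0 (h isT)) _; lra.
Qed.

End Chain.
End Steps.

(** * The lower bound on the mixing time *)

(** (te/n)^n is at most c^(n/rho) for these times, and n >= rho with c <= 1. *)
Lemma exp_coeff_short_time (R : realType) (c q rho t : R) (n : nat) :
    0 < c <= 1 -> 0 <= q <= 1 -> 0 < rho <= n%:R ->
    0 <= t <= c `^ (1 / rho) * (q / expR 1) * rho ->
  exp_coeff t n <= c.
Proof.
move=> /andP[c0 c1] /andP[q0 q1] /andP[rho0 rhon] /andP[t0 tT].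
have nR : 0 < n%:R :> R by exact: lt_le_trans rhon.
have n0 : (0 < n)%N by rewrite -(ltr0n R).
apply: le_trans (exp_coeff_le_pow t0 n0) _.
apply: le_trans (_ : (c `^ (1 / rho)) ^+ n <= _).
  apply: lerXn2r; rewrite ?nnegrE ?powR_ge0 ?divr_ge0 ?mulr_ge0 ?expR_ge0//.
  rewrite ler_pdivrMr// -ler_pdivlMr ?expR_gt0//; apply: le_trans tT _.
  have -> : c `^ (1 / rho) * (q / expR 1) * rho = c `^ (1 / rho) * (q * rho) / expR 1.
    by ring.
  rewrite ler_wpM2r ?invr_ge0 ?expR_ge0// ler_wpM2l ?powR_ge0//.
  by apply: le_trans rhon; rewrite ler_piMl// ltW.
rewrite -powR_mulrn ?powR_ge0// -powRrM; apply: ge1r_powR; first by rewrite c0.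
by rewrite mulrAC mul1r ler_pdivlMr// mul1r.
Qed.

(** At radius n - 1 the ball contains every state reached with fewer than n jumps.
    On its complement |p - 1| >= 1 - p, so the distance is at least the difference
    between the masses that pi and p_t(x, .) give to the complement. *)
Lemma l1_distance_ge (R : realType) (X : finType) (Q : X -> X -> R) (pi : X -> R)
    (chain : finite_markov_chain Q pi) (x : X) (n : nat) (t : R) : 0 <= t ->
    \sum_(y in walk_ball Q x n) pi y <= 2^-1 ->
  2^-1 - exp_coeff t n <= \sum_y pi y * `|heat_kernel Q pi t x y - 1|.
Proof.
move=> t0 ball_half.
have pi_gt0 y : 0 < pi y by case/andP: (measure_itv chain y).
pose A := (~: walk_ball Q x n)%SET.
have far : \sum_(y in A) pi y * heat_kernel Q pi t x y <= exp_coeff t n.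
  apply: (heat_mass_le chain t0) => j y jn; rewrite inE => yA.
  apply/eqP; apply: contraNT yA => /(walk_ball_support chain)/bigcupP[k _ yk].
  by apply/bigcupP; exists (widen_ord jn k).
have massA : 2^-1 <= \sum_(y in A) pi y.
  have := measure_sum chain; rewrite (bigID (mem (walk_ball Q x n))) /=.
  rewrite [X in _ + X](eq_bigl (fun y => y \in A)); last by move=> y; rewrite !inE.
  by lra.
apply: le_trans (_ : \sum_(y in A) pi y * (1 - heat_kernel Q pi t x y) <= _).
  under [leRHS]eq_bigr => y _ do rewrite mulrBr mulr1.
  by rewrite sumrB; lra.
rewrite [leLHS]big_mkcond; apply: ler_sum => y _; case: ifP => _.
  by rewrite ler_wpM2l ?(ltW (pi_gt0 y))// distrC ler_norm.
by rewrite mulr_ge0// ltW.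
Qed.

Theorem lemma7p4 (R : realType) (X : finType) (Q : X -> X -> R) (pi : X -> R)
    (chain : finite_markov_chain Q pi)
    (pi_max_lt : pi_max pi < 4^-1)
    (Q_min_lt1 : Q_min Q < 1)
    (R0_gt0 : 0 < R0 Q pi) :
  (((pi_min pi / (8 * pi_max pi)) `^ (1 / R0 Q pi)
      * (Q_min Q / expR 1) * R0 Q pi)%:E
    <= avg_mixing_time Q pi (4^-1))%E.
Proof.
have pi_gt0 y : 0 < pi y by case/andP: (measure_itv chain y).
have q0 := Q_min_gt0 Q.
have [x0 _] := state_exists chain.
have pmax0 : 0 < pi_max pi by exact: lt_le_trans (pi_gt0 x0) (pi_le_max _ _).
have pmin0 : 0 < pi_min pi by apply/bigmin_gtP.
have pminmax : pi_min pi <= pi_max pi.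
  by apply: le_trans (pi_le_max pi x0); exact: bigmin_le.
have c8 : pi_min pi / (8 * pi_max pi) <= 8^-1.
  by rewrite ler_pdivrMr ?mulr_gt0// mulKf// gt_eqF.
have /andP[rR Rr] := truncn_itv (ltW R0_gt0).
set r := Num.truncn _ in rR Rr.
have qr : 4 * pi_max pi <= Q_min Q ^+ r.
  rewrite -ler_ln ?posrE ?exprn_gt0 ?mulr_gt0// lnXn//.
  by move: rR; rewrite /R0 ler_ndivlMr ?mulr_natl ?ln_lt0 ?q0.
apply: le_ereal_inf_tmp => _ [t [t0 L1] <-].
rewrite lee_fin leNgt; apply/negP => tT.
(* r <= R0 bounds the ball, r + 1 > R0 bounds the number of jumps. *)
have small : exp_coeff t r.+1 <= 8^-1.
  apply: (le_trans _ c8); apply: (@exp_coeff_short_time _ _ (Q_min Q) (R0 Q pi)).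
  - by rewrite divr_gt0 ?mulr_gt0//= (le_trans c8)// invf_le1// ler1n.
  - by rewrite !ltW.
  - by rewrite R0_gt0 ltW.
  - by rewrite !ltW.
have : 3 / 8 <= \sum_x \sum_y pi x * pi y * `|heat_kernel Q pi t x y - 1|.
  rewrite -[leLHS]mul1r -[X in X * _ <= _](measure_sum chain) mulr_suml.
  apply: ler_sum => x _.
  under eq_bigr => y _ do rewrite -mulrA.
  rewrite -mulr_sumr ler_wpM2l ?(ltW (pi_gt0 x))//.
  apply: le_trans (l1_distance_ge chain (ltW t0)
    (pi_walk_ball_le chain x pi_max_lt qr)).
  by move: small; clear; lra.
by move=> /le_trans/(_ L1); clear; lra.
Qed.
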